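(* Let $p$ be a prime number. The scheme $\underline{\mathrm{Hom}}_{\mathbb{Z}}^{\mathrm{full}}((\mathbb{Z}/p\mathbb{Z})^2,\mu_p \times \mu_p)$ of full homomorphisms is flat over $\mathbb{Z}$.
   Context: $p$ is a prime, $\Phi_p(X)=1+X+\dots+X^{p-1}$, and $\mu_p$ is the group scheme of $p$-th roots of unity over $\mathbb{Z}$. The scheme $\underline{\mathrm{Hom}}_{\mathbb{Z}}((\mathbb{Z}/p\mathbb{Z})^2,\mu_p\times\mu_p)$ of group scheme homomorphisms is $\mathrm{Spec}(\mathcal{A})$ with $$\mathcal{A}=\mathbb{Z}[S,T,U,V]/(S^p-1,T^p-1,U^p-1,V^p-1),$$ the universal homomorphism being $h=\begin{pmatrix} S & T \\ U & V \end{pmatrix}$, i.e. $(1,0)\mapsto (S,U)$, $(0,1)\mapsto (T,V)$. An element $(x,y)$ of $\mu_p\times\mu_p$ is called primitive if $\Phi_p(x)\Phi_p(y)=0$. A pair of elements of $\mu_p\times\mu_p$ is called linearly independent if every non-trivial $\mathbb{F}_p$-linear combination (written multiplicatively) is primitive. The closed subscheme $\underline{\mathrm{Hom}}^{\mathrm{full}}_{\mathbb{Z}}((\mathbb{Z}/p\mathbb{Z})^2,\mu_p\times\mu_p)\subset \mathrm{Spec}(\mathcal{A})$ is cut out by the conditions that the two rows of $h$ are linearly independent and the two columns of $h$ are linearly independent. Explicitly it is $\mathrm{Spec}(\mathcal{A}/\mathcal{I})$, where $\mathcal{I}$ is the ideal generated by $$\{\Phi_p(S^aU^b)\Phi_p(T^aV^b),\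 \Phi_p(S^aT^b)\Phi_p(U^aV^b)\ :\ (a,b)\in\mathbb{F}_p^2\setminus\{(0,0)\}\}.$$ *)

(* Defs.v *)
From HB Require Import structures.
From mathcomp Require Import all_boot all_order all_algebra.
From mathcomp Require Import generic_quotient ring_quotient.
From mathcomp Require Import freeg mpoly.
From mathcomp Require Import boolp classical_sets.

Set Implicit Arguments.
Unset Strict Implicit.
Unset Printing Implicit Defensive.

Import GRing.Theory.

Local Open Scope ring_scope.
Local Open Scope quotient_scope.
Local Open Scope classical_set_scope.

Definition is_subgroup (V : zmodType) (H : set V) : Prop :=
  H 0 /\ forall x y, H x -> H y -> H (x - y).

Definition is_ideal (R : comPzRingType) (J : set R) : Prop :=
  is_subgroup J /\ forall a x, J x -> J (a * x).

(* Membership is made boolean by excluded middle because [Quotient.quot]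
   expects a boolean predicate. *)
Definition subgroup_gen (V : zmodType) (X : set V) : V -> bool :=
  fun v => `[< smallest (@is_subgroup V) X v >].

Definition ideal_gen (R : comPzRingType) (X : set R) : R -> bool :=
  fun r => `[< smallest (@is_ideal R) X r >].

Lemma subgroup_gen_closed (V : zmodType) (X : set V) :
  zmod_closed (subgroup_gen X).
Proof.
split=> [|x y]; first by apply/asboolP => H [] [].
move=> /asboolP Hx /asboolP Hy; apply/asboolP => H HX.
by apply: HX.1.2; [apply: Hx | apply: Hy].
Qed.

HB.instance Definition _ (V : zmodType) (X : set V) :=
  GRing.isZmodClosed.Build V (subgroup_gen X) (subgroup_gen_closed X).

Lemma ideal_gen_closed (R : comPzRingType) (X : set R) :
  zmod_closed (ideal_gen X).
Proof.
split=> [|x y]; first by apply/asboolP => J [] [] [].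
move=> /asboolP Jx /asboolP Jy; apply/asboolP => J JX.
by apply: JX.1.1.2; [apply: Jx | apply: Jy].
Qed.

HB.instance Definition _ (R : comPzRingType) (X : set R) :=
  GRing.isZmodClosed.Build R (ideal_gen X) (ideal_gen_closed X).

Lemma ideal_genM (R : comPzRingType) (X : set R) (a x : R) :
  x \in ideal_gen X -> a * x \in ideal_gen X.
Proof.
move=> /asboolP Jx; apply/asboolP => J JX.
by apply: JX.1.2; apply: Jx.
Qed.

(* [{ideal_quot I}] from ring_quotient only has a ring structure when [I] is
   proper; [quot_ring X], the quotient of [R] by the ideal generated by [X],
   is a possibly trivial ring. *)
Section QuotRing.
Variables (R : comPzRingType) (X : set R).

Local Notation Q := (Quotient.quot (GRing.ZmodClosed.clone R (ideal_gen X) _)).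

Definition quot_ring : Type := Q.

HB.instance Definition _ := GRing.Zmodule.on quot_ring.

Definition quot_pi (x : R) : quot_ring := \pi_Q x.

Lemma quot_piP (x y : R) :
  reflect (quot_pi x = quot_pi y) (x - y \in ideal_gen X).
Proof. by rewrite Quotient.idealrBE; apply: eqP. Qed.

Definition quot_repr (q : quot_ring) : R := repr (q : Q).

Lemma quot_reprK : cancel quot_repr quot_pi.
Proof. exact: reprK. Qed.

Lemma quot_pi_zmod_morphism : zmod_morphism quot_pi.
Proof. exact: raddfB. Qed.

HB.instance Definition _ :=
  GRing.isZmodMorphism.Build R quot_ring quot_pi quot_pi_zmod_morphism.

Definition quot_mul (p q : quot_ring) : quot_ring :=
  quot_pi (quot_repr p * quot_repr q).

Lemma quot_piM x y : quot_mul (quot_pi x) (quot_pi y) = quot_pi (x * y).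
Proof.
apply/quot_piP; set x' := quot_repr _; set y' := quot_repr _.
have hx : x' - x \in ideal_gen X by apply/quot_piP; rewrite quot_reprK.
have hy : y' - y \in ideal_gen X by apply/quot_piP; rewrite quot_reprK.
have -> : x' * y' - x * y = y' * (x' - x) + x * (y' - y).
  by rewrite !mulrBr [y' * x']mulrC [y' * x]mulrC addrA subrK.
by rewrite rpredD // ideal_genM.
Qed.

Lemma quot_mulA : associative quot_mul.
Proof.
move=> p q r; rewrite -[p]quot_reprK -[q]quot_reprK -[r]quot_reprK.
by rewrite !quot_piM mulrA.
Qed.

Lemma quot_mulC : commutative quot_mul.
Proof. by move=> p q; rewrite /quot_mul mulrC. Qed.

Lemma quot_mul1 : left_id (quot_pi 1) quot_mul.
Proof. by move=> p; rewrite -[p]quot_reprK quot_piM mul1r. Qed.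

Lemma quot_mulDl : left_distributive quot_mul +%R.
Proof.
move=> p q r; rewrite -[p]quot_reprK -[q]quot_reprK -[r]quot_reprK.
by rewrite -raddfD !quot_piM mulrDl raddfD.
Qed.

HB.instance Definition _ := GRing.Zmodule_isComPzRing.Build quot_ring
  quot_mulA quot_mulC quot_mul1 quot_mulDl.

Lemma quot_pi_monoid_morphism : monoid_morphism quot_pi.
Proof. by split=> [|x y] //; rewrite -quot_piM. Qed.

HB.instance Definition _ :=
  GRing.isMonoidMorphism.Build R quot_ring quot_pi quot_pi_monoid_morphism.

End QuotRing.

Section Tensor.
Variable R : comPzRingType.
Implicit Types M N : lmodType R.

Variant tensor_rel M N : set {freeg (M * N)%type / int} :=
| TensorDl (m m' : M) (n : N) :
    tensor_rel (<< (m + m', n) >> - (<< (m, n) >> + << (m', n) >>))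
| TensorDr (m : M) (n n' : N) :
    tensor_rel (<< (m, n + n') >> - (<< (m, n) >> + << (m, n') >>))
| TensorZ (a : R) (m : M) (n : N) :
    tensor_rel (<< (a *: m, n) >> - << (m, a *: n) >>).

Local Notation Q M N :=
  (Quotient.quot (GRing.ZmodClosed.clone {freeg (M * N)%type / int}
                    (subgroup_gen (@tensor_rel M N)) _)).

(* The underlying abelian group of M (x)_R N. *)
Definition tensor M N : Type := Q M N.

HB.instance Definition _ M N := GRing.Zmodule.on (tensor M N).

Definition tensor_pi M N (x : {freeg (M * N)%type / int}) : tensor M N :=
  \pi_(Q M N) x.

Definition tensor_repr M N (t : tensor M N) : {freeg (M * N)%type / int} :=
  repr (t : Q M N).

Definition pure_tensor M N (m : M) (n : N) : tensor M N :=
  tensor_pi << (m, n) >>.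

(* The group morphism sending m (x) n to b m n; meaningful for [b] balanced,
   see [tensor_liftE]. *)
Definition tensor_lift M N (P : zmodType) (b : M -> N -> P) (t : tensor M N) :
    P :=
  fglift (fun mn => b mn.1 mn.2 : zmodule P) (tensor_repr t).

Definition balanced M N (P : zmodType) (b : M -> N -> P) : Prop :=
  [/\ forall m m' n, b (m + m') n = b m n + b m' n,
      forall m n n', b m (n + n') = b m n + b m n'
    & forall (a : R) m n, b (a *: m) n = b m (a *: n)].

Definition tensor_map M N N' (f : N -> N') : tensor M N -> tensor M N' :=
  tensor_lift (fun m n => pure_tensor m (f n)).

Lemma tensor_piP M N (x y : {freeg (M * N)%type / int}) :
  reflect (tensor_pi x = tensor_pi y)
          (x - y \in subgroup_gen (@tensor_rel M N)).
Proof. by rewrite Quotient.idealrBE; apply: eqP. Qed.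

Lemma tensor_reprK M N : cancel (@tensor_repr M N) (@tensor_pi M N).
Proof. exact: reprK. Qed.

Lemma tensor_pi_zmod_morphism M N : zmod_morphism (@tensor_pi M N).
Proof. exact: raddfB. Qed.

HB.instance Definition _ M N :=
  GRing.isZmodMorphism.Build {freeg (M * N)%type / int} (tensor M N)
    (@tensor_pi M N) (@tensor_pi_zmod_morphism M N).

Lemma pure_tensor_balanced M N : balanced (@pure_tensor M N).
Proof.
by split=> *; rewrite -?raddfD; apply/tensor_piP/asboolP => H [_]; apply;
  [exact: TensorDl | exact: TensorDr | exact: TensorZ].
Qed.

Lemma tensor_lift_pi M N (P : zmodType) (b : M -> N -> P) x : balanced b ->
  tensor_lift b (tensor_pi x) = fglift (fun mn => b mn.1 mn.2 : zmodule P) x.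
Proof.
move=> [bDl bDr bZ]; rewrite /tensor_lift; set g := fglift _.
have gB : zmod_morphism g by apply: lift_is_additive.
have g0 : g 0 = 0 by rewrite -[X in g X](subrr 0) gB subrr.
have gD u v : g (u + v) = g u + g v.
  by rewrite -[v in LHS]opprK -[- v]sub0r !gB g0 sub0r opprK.
have gU m n : g << (m, n) >> = b m n by rewrite /g liftU scale1r.
apply/eqP; rewrite -subr_eq0 -gB; apply/eqP.
have /asboolP xK := introT (tensor_piP _ _) (tensor_reprK (tensor_pi x)).
suff kerP : is_subgroup [set z | g z = 0] /\ @tensor_rel M N `<=` [set z | g z = 0].
  exact: (xK _ kerP).
split.
  by split=> [|u v /= gu gv]; rewrite /= ?g0 // gB gu gv subrr.
by move=> _ [] * /=; rewrite gB ?gD !gU ?(bDl, bDr, bZ) subrr.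
Qed.

Lemma tensor_liftE M N (P : zmodType) (b : M -> N -> P) m n : balanced b ->
  tensor_lift b (pure_tensor m n) = b m n.
Proof. by move=> bb; rewrite tensor_lift_pi // liftU scale1r. Qed.

Lemma tensor_lift_zmod_morphism M N (P : zmodType) (b : M -> N -> P) :
  balanced b -> zmod_morphism (tensor_lift b).
Proof.
move=> bb s t; rewrite -[s]tensor_reprK -[t]tensor_reprK -raddfB.
by rewrite !tensor_lift_pi // lift_is_additive.
Qed.

Lemma tensor_map_balanced M N N' (f : {linear N -> N'}) :
  balanced (fun (m : M) n => pure_tensor m (f n)).
Proof.
have [tDl tDr tZ] := @pure_tensor_balanced M N'.
by split=> *; rewrite ?raddfD ?linearZ ?(tDl, tDr, tZ).
Qed.

Definition flat (M : lmodType R) : Prop :=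
  forall (N N' : lmodType R) (f : {linear N -> N'}),
    injective f -> injective (@tensor_map M N N' f).

End Tensor.

(* The affine scheme Hom((Z/p)^2, mu_p * mu_p) is represented by its coordinate
   ring Z[S,T,U,V] / (S^p - 1, T^p - 1, U^p - 1, V^p - 1); S, T, U, V are the
   variables 0, 1, 2, 3. *)
Definition hom_ring (p : nat) : comPzRingType :=
  @quot_ring {mpoly int[4]} [set 'X_i ^+ p - 1 | i in [set: 'I_4]].

Section FullHom.
Variable p : nat.
Local Notation A := (hom_ring p).

Definition hom_coord (i : nat) : A := quot_pi _ 'X_(inord i).

Local Notation S := (hom_coord 0).
Local Notation T := (hom_coord 1).
Local Notation U := (hom_coord 2).
Local Notation V := (hom_coord 3).

Definition Phi (x : A) : A := \sum_(i < p) x ^+ i.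

(* The point [x] of mu_p * mu_p is primitive where this function vanishes. *)
Definition primitive_eq (x : A * A) : A := Phi x.1 * Phi x.2.

(* For a prime p, the residues of 'F_p are represented by 0, ..., p - 1. *)
Definition mu_comb (x y : A * A) (c : 'F_p * 'F_p) : A * A :=
  (x.1 ^+ c.1 * y.1 ^+ c.2, x.2 ^+ c.1 * y.2 ^+ c.2).

Definition lin_indep_eqs (x y : A * A) : set A :=
  [set primitive_eq (mu_comb x y c) | c in [set c | c != 0]].

(* The universal homomorphism has rows (S, T), (U, V) and columns (S, U),
   (T, V). *)
Definition full_hom_ring : comPzRingType :=
  quot_ring (lin_indep_eqs (S, T) (U, V) `|` lin_indep_eqs (S, U) (T, V)).

End FullHom.

(* Main.v *)
Require Import Defs.
From HB Require Import structures.
From mathcomp Require Import all_boot all_order all_algebra.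
From mathcomp Require Import freeg mpoly.
From mathcomp Require Import boolp classical_sets.
From mathcomp Require Import zify ring.

Set Implicit Arguments.
Unset Strict Implicit.
Unset Printing Implicit Defensive.

Import GRing.Theory Num.Theory.

Local Open Scope ring_scope.

(** Put F = F_p and G = M_2(F). The ring of Hom is the group ring Z[G], a
    matrix X standing for the monomial with exponents X, and since Phi_p(x) is
    the sum of the powers of x, the generators of the ideal of full
    homomorphisms are the sums over the subgroups of matrices c r, with c a
    fixed nonzero column and r any row, together with their transposes. So the
    ideal is the lattice spanned by the indicators of the cosets of these
    subgroups, which are the sets w X = v and X w = v with w on the projective
    line over F and v in F^2 ([gen], [gen_relationP]). The theorem amounts to
    this lattice being a direct summand of Z^G: the projection onto a complement
    then gives the quotient a finite dual basis, so that it is flat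
    ([flat_dual_basis]).

    A lattice with spanning matrix S is a direct summand as soon as its rank r
    is the rank of S modulo every prime. In the form used here
    ([lattice_retraction]), two r-tuples C, C' of elements of the lattice are
    paired with integral functionals D, D', with coprime nonzero determinants
    det(C D) and det(C' D'). Each pair gives an endomorphism of Z^G with image
    in the lattice that is multiplication by the determinant on the lattice,
    and a Bezout combination is a retraction onto the lattice.

    Away from p: over Q the indicators of X u = c are linear combinations of
    those of w X = v, because a nonzero vector is orthogonal to exactly one
    point of the line ([gen_sub_basis]). This gives a basis of
    1 + (p + 1)(p^2 - 1) elements and a pairing whose determinant is a power of
    p ([det_basis]).

    At p: functions on G with values in F are polynomials in the entries of X,
    of degree less than p in each. The lattice contains, modulo p, the
    functions (w X)_1^i (w X)_2^j for all w, hence the linear combinations that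
    separate their parts of given row degrees ([row_fun]), and similarly with
    the rows and columns exchanged. If d = i + j >= p all the p + 1 combinations
    given by the points w are needed, while if d < p there are only d + 1. This
    loses p - d functions for each (i, j) with d < p. For d > 0 they are
    recovered from the functions of the X w of degree p + d - 1, whose
    monomials are different ([item_of], [sum_item_pivot_neq]); the p functions
    lost for d = 0 are the difference between p^2 (p + 1), the number of the
    triples (i, j, w), and the rational rank. Extracting one monomial per
    function gives a diagonal pairing with entries prime to p
    ([items_pairing]). *)

(** * Flatness from a finite dual basis *)

Lemma tensor_ind (R : comPzRingType) (M N : lmodType R) (P : tensor M N -> Prop) :
  P 0 -> (forall s t, P s -> P t -> P (s - t)) ->
  (forall m n, P (pure_tensor m n)) -> forall t, P t.
Proof.
move=> P0 PB Ppure t; rewrite -[t]tensor_reprK.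
have PN s : P s -> P (- s) by move=> Ps; rewrite -sub0r; apply: PB.
have PD s u : P s -> P u -> P (s + u).
  by move=> Ps Pu; rewrite -[u]opprK; apply: PB => //; apply: PN.
elim/freeg_ind_dom0: (tensor_repr t) => [|k [m n] D _ _ PE]; first by rewrite raddf0.
rewrite raddfD; apply: (PD) => //.
have -> : << k *g (m, n) >> = << (m, n) >> *~ k.
  by rewrite freeg_mulz intz.
rewrite raddfMz; change (P (pure_tensor m n *~ k)).
have PMn j : P (pure_tensor m n *+ j).
  by elim: j => [|j IH]; rewrite ?mulr0n // mulrS; apply: PD.
by case: k => j; rewrite ?NegzE ?mulrNz -pmulrn; last apply: PN.
Qed.

(** Contracting the left factor against the coordinate functions expresses a
    tensor t as the sum of the e_j (x) lam_j(t) with lam_j(t) in N, and these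
    contractions are natural in N: hence t is determined by its image under an
    injective map, as each lam_j(t) is. *)
Lemma flat_dual_basis (R : comPzRingType) (M : lmodType R) (J : finType)
    (e : J -> M) (lam : J -> M -> R) :
  (forall j x y, lam j (x + y) = lam j x + lam j y) ->
  (forall j a x, lam j (a *: x) = a * lam j x) ->
  (forall x, x = \sum_j lam j x *: e j) -> flat M.
Proof.
move=> lamD lamZ lamE N N' f injf t t' eq_ft.
pose c (K : lmodType R) j (m : M) (k : K) := lam j m *: k.
have cbal (K : lmodType R) j : balanced (@c K j).
  by split=> *; rewrite /c ?lamD ?lamZ ?scalerDl ?scalerDr // mulrC scalerA.
have cB (K : lmodType R) j := tensor_lift_zmod_morphism (cbal K j).
have cf j u : tensor_lift (@c N' j) (tensor_map f u) = f (tensor_lift (@c N j) u).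
  have fB := tensor_lift_zmod_morphism (@tensor_map_balanced _ M _ _ f).
  elim/tensor_ind: u => [|s u es eu|m n].
  - have z0 (U V : zmodType) (g : U -> V) : zmod_morphism g -> g 0 = 0.
      by move=> gB; rewrite -[X in g X](subrr 0) gB subrr.
    by rewrite /tensor_map !(z0 _ _ _ fB) !(z0 _ _ _ (cB _ _)) raddf0.
  - have -> : tensor_map f (s - u) = tensor_map f s - tensor_map f u by apply: fB.
    by rewrite !cB es eu raddfB.
  rewrite /tensor_map tensor_liftE; last exact: tensor_map_balanced.
  by rewrite !tensor_liftE // /c linearZ.
have expand u : u = \sum_j pure_tensor (e j) (tensor_lift (@c N j) u).
  have [tDl tDr tZ] := @pure_tensor_balanced R M N.
  have tr0 (m : M) : pure_tensor m (0 : N) = 0.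
    by apply: (addrI (pure_tensor m 0)); rewrite -tDr !addr0.
  have tl0 (n : N) : pure_tensor (0 : M) n = 0.
    by apply: (addrI (pure_tensor 0 n)); rewrite -tDl !addr0.
  have trB (m : M) (n n' : N) :
      pure_tensor m (n - n') = pure_tensor m n - pure_tensor m n'.
    apply: (addIr (pure_tensor m n')).
    by rewrite -tDr !subrK.
  elim/tensor_ind: u => [|s u es eu|m n].
  - rewrite big1 // => j _; rewrite -[X in tensor_lift _ X](subrr 0) cB subrr.
    exact: tr0.
  - rewrite {1}es {1}eu -sumrB; apply: eq_bigr => j _; by rewrite cB trB.
  rewrite {1}[m]lamE; under [RHS]eq_bigr => j _ do
    rewrite tensor_liftE // /c -tZ.
  pose g (m' : M) := pure_tensor m' n.
  have gD : {morph g : a b / a + b} by move=> a b; apply: tDl.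
  exact: (big_morph g gD (tl0 n)).
rewrite [t]expand [t']expand; apply: eq_bigr => j _; congr pure_tensor.
by apply: injf; rewrite -!cf eq_ft.
Qed.

(** * Retractions onto sublattices *)

(** Over the rationals, C and C0 have the same row space, being of the same
    height with C of full rank; so S = E C for a rational E, and
    S D adj(C D) C = E (C D) adj(C D) C = det(C D) S. *)
Lemma mulmx_adj_saturated (k r n : nat) (S : 'M[int]_(k, n))
    (C0 C : 'M[int]_(r, n)) (D : 'M[int]_(n, r)) (A : 'M[int]_(r, k)) :
  (map_mx intr S <= (map_mx intr C0 : 'M[rat]_(r, n)))%MS -> C = A *m S ->
  \det (C *m D) != 0 ->
  S *m (D *m \adj (C *m D) *m C) = \det (C *m D) *: S.
Proof.
move=> S_le CAS d0; suff inj (X Y : 'M[int]_(k, n)) :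
    map_mx (intr : int -> rat) X = map_mx intr Y -> X = Y; first apply: inj.
  2: move=> /matrixP eXY; apply/matrixP => i j; have := eXY i j.
  2: by rewrite !mxE; apply: intr_inj.
rewrite map_mxZ !map_mxM map_mx_adj map_mxM -det_map_mx map_mxM.
move: d0; rewrite -(intr_eq0 rat) -det_map_mx map_mxM.
move: CAS => /(congr1 (map_mx (@intmul rat 1))); rewrite map_mxM.
move: S_le.
(* From here on, all matrices are rational. *)
move: (map_mx _ S) (map_mx _ C0) (map_mx _ C) (map_mx _ D) (map_mx _ A).
move=> {S C0 C D A} S C0 C D A S_le CAS d0.
have rC : \rank C = r.
  apply/eqP; rewrite eqn_leq rank_leq_row /=.
  have : row_free (C *m D) by rewrite row_free_unit unitmxE unitfE.
  by move=> /eqP {1}<-; apply: mxrankM_maxl.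
have C_le : (C <= C0)%MS by rewrite CAS (submx_trans (submxMl _ _)).
have C0_le : (C0 <= C)%MS.
  have := mxrank_leqif_sup C_le => /geq_leqif <-.
  by rewrite rC rank_leq_row.
have /submxP [E ->] := submx_trans S_le C0_le.
by rewrite !mulmxA -(mulmxA E) -(mulmxA E) mul_mx_adj mul_mx_scalar scalemxAl.
Qed.

(** The two multiples of S provided by [mulmx_adj_saturated] are combined by a
    Bezout relation between the determinants. *)
Lemma lattice_retraction (k r n : nat) (S : 'M[int]_(k, n))
    (C C' : 'M[int]_(r, n)) (D D' : 'M[int]_(n, r)) (A A' : 'M[int]_(r, k)) :
  (map_mx intr S <= (map_mx intr C : 'M[rat]_(r, n)))%MS ->
  C = A *m S -> C' = A' *m S -> coprimez (\det (C *m D)) (\det (C' *m D')) ->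
  \det (C *m D) != 0 -> \det (C' *m D') != 0 ->
  exists B : 'M[int]_(n, k), S *m (B *m S) = S.
Proof.
move=> S_le CE C'E /coprimezP [[u v] /= uv] d0 d'0.
exists (u *: (D *m \adj (C *m D) *m A) + v *: (D' *m \adj (C' *m D') *m A')).
rewrite mulmxDl mulmxDr -!scalemxAl -!scalemxAr -!(mulmxA _ A) -!(mulmxA _ A').
rewrite -CE -C'E (mulmx_adj_saturated S_le CE d0).
by rewrite (mulmx_adj_saturated S_le C'E d'0) !scalerA -scalerDl uv scale1r.
Qed.

Definition mx_of (I J : finType) (R : Type) (f : I -> J -> R) :
    'M[R]_(#|I|, #|J|) :=
  \matrix_(i, j) f (enum_val i) (enum_val j).

Lemma mx_of_inj (I J : finType) (R : Type) (f g : I -> J -> R) i j :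
  mx_of f = mx_of g -> f i j = g i j.
Proof.
move=> /matrixP/(_ (enum_rank i) (enum_rank j)).
by rewrite !mxE !enum_rankK.
Qed.

Lemma mx_ofK (I J : finType) (R : Type) (A : 'M[R]_(#|I|, #|J|)) :
  A = mx_of (fun i j => A (enum_rank i) (enum_rank j)).
Proof. by apply/matrixP => i j; rewrite mxE !enum_valK. Qed.

Lemma mul_mx_of (I J K : finType) (R : pzSemiRingType) (f : I -> J -> R)
    (g : J -> K -> R) :
  mx_of f *m mx_of g = mx_of (fun i k => \sum_j f i j * g j k).
Proof.
apply/matrixP => i k; rewrite !mxE (reindex (fun j : 'I_#|J| => enum_val j)).
  by apply: eq_bigr => j _; rewrite !mxE.
by exists enum_rank => j _; rewrite ?enum_valK ?enum_rankK.
Qed.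

Lemma det_mx_of_diag (I : finType) (R : comPzRingType) (f : I -> I -> R) :
  (forall i j, i != j -> f i j = 0) -> \det (mx_of f) = \prod_i f i i.
Proof.
move=> f0; have -> : mx_of f = diag_mx (\row_i f (enum_val i) (enum_val i)).
  apply/matrixP => i j; rewrite !mxE; case: eqVneq => [->|ij] //=.
  by rewrite mulr0n f0 // (inj_eq enum_val_inj).
rewrite det_diag [RHS](reindex (fun j : 'I_#|I| => enum_val j)).
  by apply: eq_bigr => j _; rewrite !mxE.
by exists enum_rank => j _; rewrite ?enum_valK ?enum_rankK.
Qed.

(** * Matrices of order two and the projective line *)

Section Matrices.
Variable F : finFieldType.
Local Notation vec := (F * F)%type.
Local Notation mat := (vec * vec)%type.
(* The points (1 : t) and (0 : 1) of the projective line. *)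
Local Notation line := (option F).

Definition dot (w : line) (z : vec) : F :=
  if w is Some t then z.1 + t * z.2 else z.2.

Definition transp (X : mat) : mat := ((X.1.1, X.2.1), (X.1.2, X.2.2)).

(** The product w X, the point w being the row (1, t) or (0, 1). *)
Definition row_mul (w : line) (X : mat) : vec :=
  (dot w (transp X).1, dot w (transp X).2).

Lemma transpK : involutive transp.
Proof. by case=> [[a b] [c d]]. Qed.

Lemma dot_row_mul (u w : line) (X : mat) :
  dot u (row_mul w X) = dot w (row_mul u (transp X)).
Proof. by case: X => [[a b] [c d]]; case: u w => [s|] [t|] //=; ring. Qed.

Lemma dotB (w : line) (y z : vec) : dot w (y - z) = dot w y - dot w z.
Proof. by case: w => [t|] //=; ring. Qed.

Lemma row_mul_pair_inj (w w' : line) : w != w' ->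
  injective (fun X => (row_mul w X, row_mul w' X)).
Proof.
move=> ww' [[a b] [c d]] [[a' b'] [c' d']].
rewrite /row_mul /=; case: w w' ww' => [t|] [t'|] //=; last first.
- by move=> _ [-> -> /addIr -> /addIr ->].
- by move=> _ [+ + ec ed]; rewrite ec ed => /addIr -> /addIr ->.
rewrite (inj_eq Some_inj) -subr_eq0 => tt' [e1 e2 e3 e4].
have solve (x y x' y' : F) : x + t * y = x' + t * y' ->
    x + t' * y = x' + t' * y' -> x = x' /\ y = y'.
  move=> E1 E2; have yy' : y = y'.
    apply: (mulfI tt'); transitivity ((x + t * y) - (x + t' * y)); first by ring.
    by rewrite E1 E2; ring.
  by split=> //; move: E1; rewrite yy' => /addIr.
by have [-> ->] := solve _ _ _ _ e1 e3; have [-> ->] := solve _ _ _ _ e2 e4.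
Qed.

Lemma sum_row_mul2 (R : comPzRingType) (w w' : line) (f g : vec -> R) :
  w != w' -> \sum_X f (row_mul w X) * g (row_mul w' X) = (\sum_v f v) * \sum_v g v.
Proof.
move=> ww'; rewrite big_distrlr /= pair_bigA /=.
by rewrite [RHS](reindex_inj (row_mul_pair_inj ww')).
Qed.

Lemma sum_row_mul (R : comPzRingType) (w : line) (f : vec -> R) :
  \sum_X f (row_mul w X) = (#|F| ^ 2)%:R * \sum_v f v.
Proof.
have [w' ww'] : exists w', w != w'.
  by case: w => [t|]; [exists None | exists (Some 0)].
have := sum_row_mul2 f (fun=> 1) ww'.
under eq_bigr => X _ do rewrite mulr1.
by move=> ->; rewrite mulrC sumr_const card_prod mulnn.
Qed.

Lemma sum_delta (R : pzSemiRingType) (T : finType) (a : T) (f : T -> R) :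
  \sum_x (x == a)%:R * f x = f a.
Proof.
rewrite (bigD1 a) //= eqxx mul1r big1 ?addr0 // => x /negPf ->.
by rewrite mul0r.
Qed.

Lemma sum_eq (R : pzSemiRingType) (T : finType) (a : T) :
  \sum_x (x == a)%:R = 1 :> R.
Proof. by rewrite -[RHS](sum_delta a (fun=> 1)); under [RHS]eq_bigr do rewrite mulr1. Qed.

Lemma sum_dot_eq0 (z : vec) :
  \sum_w (dot w z == 0)%:R = 1 + #|F|%:R * (z == 0)%:R :> rat.
Proof.
rewrite (bigD1 None) //= (reindex_omap Some id) => [|[t|]] //=.
rewrite (eq_bigl xpredT) => [|t]; last by rewrite eqxx.
case: z => x y /=; rewrite xpair_eqE; have [->|y0] := eqVneq y 0.
  rewrite andbT; under eq_bigr => t _ do rewrite mulr0 addr0.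
  by rewrite sumr_const mulr_natl.
rewrite andbF mulr0 add0r addr0 -[RHS](sum_eq _ (- x / y)); apply: eq_bigr => t _.
congr (_%:R); congr nat_of_bool.
by rewrite addrC addr_eq0 -(can2_eq (mulfK y0) (mulfVK y0)).
Qed.

End Matrices.

(** * The lattice spanned by the generators, over the rationals *)

Section Generators.
Variable F : finFieldType.
Local Notation vec := (F * F)%type.
Local Notation mat := (vec * vec)%type.
Local Notation line := (option F).

Definition gen_index : finType := (bool * line * vec)%type.

Definition gen (g : gen_index) (X : mat) : int :=
  (row_mul g.1.2 (if g.1.1 then transp X else X) == g.2)%:R.

(** A basis of the rational span of the generators consists of the constant
    function 1, indexed by (0, (1 : 0)), and of the indicators of the sets
    w X = c with c nonzero; with q = #|F|, its size is 1 + (q + 1)(q^2 - 1). *)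
Definition basis_index : finType :=
  {x : vec * line | (x.1 != 0) || (x.2 == Some 0)}.

Implicit Types x y : basis_index.

Definition basis x (X : mat) : int :=
  if (val x).1 == 0 then 1 else (row_mul (val x).2 X == (val x).1)%:R.

Definition cobasis x (X : mat) : int :=
  if (val x).1 == 0 then (X == 0)%:R else
  (row_mul (val x).2 X == (val x).1)%:R - (row_mul (val x).2 X == 0)%:R.

Lemma row_mul0 (w : line) : row_mul w 0 = 0.
Proof. by case: w => [t|] //; rewrite /row_mul /= mulr0 addr0. Qed.

Lemma sum_gen b (f : line -> vec -> int) X :
  \sum_g (g.1.1 == b)%:R * f g.1.2 g.2 * gen g X =
  \sum_w f w (row_mul w (if b then transp X else X)).
Proof.
rewrite -(pair_bigA _ (fun bw v => (bw.1 == b)%:R * f bw.2 v * gen (bw, v) X)) /=.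
rewrite -(pair_bigA _ (fun b' w => \sum_v (b' == b)%:R * f w v * gen (b', w, v) X)) /=.
rewrite exchange_big; apply: eq_bigr => w _ /=; rewrite exchange_big /=.
rewrite -[RHS](sum_delta _ (f w)); apply: eq_bigr => v _.
under eq_bigr => b' _ do rewrite -mulrA.
by rewrite sum_delta /gen /= mulrC eq_sym.
Qed.

Lemma basis_gen x : exists a : gen_index -> int,
  forall X, basis x X = \sum_g a g * gen g X.
Proof.
case: x => [[c w0] xP]; exists (fun g => (g.1.1 == false)%:R *
  ((g.1.2 == w0)%:R * (if c == 0 then 1 else (g.2 == c)%:R))) => X.
rewrite (sum_gen false (fun w v => (w == w0)%:R * (if c == 0 then 1 else (v == c)%:R))).
by rewrite sum_delta.
Qed.

Lemma sum_basis_cobasis x y : \sum_X basis x X * cobasis y X =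
  (x == y)%:R * (if (val x).1 == 0 then 1 else (#|F| ^ 2)%:R).
Proof.
have sum_diff (c : vec) : \sum_v ((v == c)%:R - (v == 0)%:R) = 0 :> int.
  by rewrite sumrB !sum_eq subrr.
case: x y => [[c w] /= xP] [[c' w'] /= yP]; rewrite -val_eqE /= xpair_eqE.
rewrite /basis /cobasis /=; have [c'0|c'0] := eqVneq c' 0.
  under eq_bigr => X _ do rewrite mulrC; rewrite sum_delta row_mul0.
  move: yP xP; rewrite c'0 eqxx /= => /eqP ->.
  have [|c0 _] := eqVneq c 0; first by move=> _ /eqP ->; rewrite eqxx.
  by rewrite mul0r.
have [c0|c0] := eqVneq c 0.
  under eq_bigr => X _ do rewrite mul1r.
  rewrite (sum_row_mul w' (fun v => (v == c')%:R - (v == 0)%:R)) sum_diff mulr0.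
  by rewrite c0 eq_sym (negPf c'0) mul0r.
have [<-|ww'] := eqVneq w w'; last first.
  rewrite (sum_row_mul2 (fun v => (v == c)%:R) (fun v => (v == c')%:R - (v == 0)%:R)) //.
  by rewrite sum_diff mulr0 andbF mul0r.
rewrite (sum_row_mul w (fun v => (v == c)%:R * ((v == c')%:R - (v == 0)%:R))).
by rewrite sum_delta (negPf c0) subr0 andbT mulrC.
Qed.

Lemma det_basis : exists n,
  \det (mx_of basis *m mx_of (fun X x => cobasis x X)) = (#|F| ^ n)%:R.
Proof.
rewrite mul_mx_of det_mx_of_diag => [|x y xy]; last first.
  by rewrite sum_basis_cobasis (negPf xy) mul0r.
elim/big_rec: _ => [|x m _ [n ->]]; first by exists 0%N.
rewrite sum_basis_cobasis eqxx mul1r; case: ifP => _; first by exists n; rewrite mul1r.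
by exists (2 + n)%N; rewrite expnD natrM.
Qed.

Let row_of (f : mat -> rat) : 'rV_#|{: mat}| := \row_j f (enum_val j).
Let spanned f := (row_of f <= map_mx (intr : int -> rat) (mx_of basis))%MS.

Let spannedZ a f : spanned f -> spanned (fun X => a * f X).
Proof.
rewrite /spanned => /(scalemx_sub a); congr (_ <= _)%MS.
by apply/rowP => j; rewrite !mxE.
Qed.

Let spannedD f g : spanned f -> spanned g -> spanned (fun X => f X + g X).
Proof.
rewrite /spanned => fs /(addmx_sub fs); congr (_ <= _)%MS.
by apply/rowP => j; rewrite !mxE.
Qed.

Let spanned_sum (T : finType) (P : pred T) (f : T -> mat -> rat) :
  (forall i, P i -> spanned (f i)) -> spanned (fun X => \sum_(i | P i) f i X).
Proof.
move=> fs; rewrite /spanned.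
have -> : row_of (fun X => \sum_(i | P i) f i X) = \sum_(i | P i) row_of (f i).
  by apply/rowP => j; rewrite !mxE summxE; under [RHS]eq_bigr do rewrite mxE.
exact: summx_sub.
Qed.

Let spanned_basis x : spanned (fun X => (basis x X)%:~R).
Proof.
have := row_sub (enum_rank x) (map_mx (intr : int -> rat) (mx_of basis)).
congr (_ <= _)%MS; apply/rowP => j; rewrite !mxE enum_rankK //.
Qed.

Let spanned_ext f g : f =1 g -> spanned f -> spanned g.
Proof.
by move=> fg; congr (_ <= _)%MS; apply/rowP => j; rewrite !mxE fg.
Qed.

Let spanned1 : spanned (fun=> 1).
Proof.
pose x0 : vec * line := (0, Some 0).
have xP : (x0.1 != 0) || (x0.2 == Some 0).
by rewrite /= !eqxx.
apply: (spanned_ext _ (spanned_basis (Sub x0 xP : basis_index))) => X.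
by rewrite /basis SubK eqxx.
Qed.

Let spanned_row_mul w c : spanned (fun X => (row_mul w X == c)%:R).
Proof.
have nz (c' : vec) : c' != 0 -> spanned (fun X => (row_mul w X == c')%:R).
  move=> c'0; pose x0 : vec * line := (c', w).
  have xP : (x0.1 != 0) || (x0.2 == Some 0).
    by rewrite c'0.
  apply: (spanned_ext _ (spanned_basis (Sub x0 xP : basis_index))) => X.
  by rewrite /basis SubK (negPf c'0) rmorph_nat.
have [->|] := eqVneq c 0; last exact: nz.
apply: (@spanned_ext (fun X =>
  1 + -1 * \sum_(c' : vec | c' != 0) (row_mul w X == c')%:R)).
  move=> X; rewrite -[X in X + _](sum_eq rat (row_mul w X)) (bigD1 (0 : vec)) //= mulN1r.
  rewrite (eq_bigr (fun c' => (row_mul w X == c')%:R)) ?addrK 1?eq_sym //.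
  by move=> c' _; rewrite eq_sym.
by apply: spannedD => //; apply: spannedZ; apply: spanned_sum.
Qed.

(** For X u = c it is required that w (X u - c) = 0 for all points w of the
    line; otherwise this happens for exactly one w. So p times the indicator of
    X u = c is a sum over w of functions of w X, less the constant 1. *)
Let spanned_col_mul u c : spanned (fun X => (row_mul u (transp X) == c)%:R).
Proof.
have q0 : #|F|%:R != 0 :> rat.
  by rewrite pnatr_eq0 -lt0n; apply/card_gt0P; exists 0.
apply: (@spanned_ext (fun X => #|F|%:R^-1 *
  (-1 + \sum_w \sum_(v | dot u v == dot w c) (row_mul w X == v)%:R))).
  move=> X; apply: (canLR (mulKf q0)); apply: (canLR (addKr _)).
  rewrite -subr_eq0 -sum_dot_eq0; apply: eq_bigr => w _.
  rewrite dotB subr_eq0 -dot_row_mul big_mkcond /=.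
  rewrite -[RHS](sum_delta (row_mul w X) (fun v => (dot u v == dot w c)%:R)).
  apply: eq_bigr => v _; rewrite [row_mul w X == v]eq_sym.
  by case: (dot u v == _); rewrite ?mulr1 ?mulr0.
apply/spannedZ/spannedD.
  exact: (@spanned_ext (fun X => -1 * 1) _ _ (spannedZ _ spanned1)).
by apply: spanned_sum => w _; apply: spanned_sum => v _.
Qed.

Lemma gen_sub_basis :
  (map_mx intr (mx_of gen) <= (map_mx intr (mx_of basis) : 'M[rat]_(_, _)))%MS.
Proof.
apply/row_subP => i; set g := enum_val i.
have -> : row i (map_mx intr (mx_of gen)) = row_of (fun X => (gen g X)%:~R).
  by apply/rowP => j; rewrite !mxE.
case: g => [[[] w] c].
  apply: (spanned_ext _ (spanned_col_mul w c)) => X; by rewrite /gen rmorph_nat.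
by apply: (spanned_ext _ (spanned_row_mul w c)) => X; rewrite /gen rmorph_nat.
Qed.

End Generators.

(** * Functions modulo p *)

(** The inverse of the Vandermonde matrix provides the functionals that extract
    the coefficients of the polynomial of degree less than #|F| representing a
    function on F. *)
Lemma coef_functional (F : finFieldType) : exists u : nat -> F -> F,
  forall m k, (m < #|F|)%N -> (k < #|F|)%N ->
  \sum_a a ^+ m * u k a = (m == k)%:R.
Proof.
pose V := @Vandermonde F #|F| #|F| (\row_j enum_val j).
have V_unit : V \in unitmx.
  rewrite unitmxE det_Vandermonde unitfE; apply/prodf_neq0 => i _.
  apply/prodf_neq0 => j ij; rewrite !mxE subr_eq0 (inj_eq enum_val_inj).
  by apply: contraTneq ij => ->; rewrite ltnn.
exists (fun k a => if insub k is Some k' then invmx V (enum_rank a) k' else 0).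
move=> m k m_lt k_lt; rewrite insubT /=.
have /matrixP/(_ (Ordinal m_lt) (Ordinal k_lt)) := mulmxV V_unit.
rewrite !mxE => <-; rewrite (reindex (fun j : 'I_#|F| => enum_val j)).
  by apply: eq_bigr => j _; rewrite !mxE enum_valK.
by exists enum_rank => j _; rewrite ?enum_valK ?enum_rankK.
Qed.

Section ModP.
Variables (F : finFieldType) (p : nat).
Hypotheses (p_pr : prime p) (pF : p \in [pchar F]).
Local Notation vec := (F * F)%type.
Local Notation mat := (vec * vec)%type.
Local Notation line := (option F).

Variable u : nat -> F -> F.
Hypothesis uP : forall m k, (m < p)%N -> (k < p)%N ->
  \sum_a a ^+ m * u k a = (m == k)%:R.

Lemma binom_coef (i a c : nat) (t : F) : (i < p)%N -> (a < p)%N -> (c < p)%N ->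
  \sum_x \sum_y (x + t * y) ^+ i * (u a x * u c y) =
  (a + c == i)%N%:R * 'C(i, c)%:R * t ^+ c.
Proof.
move=> i_lt a_lt c_lt.
transitivity (\sum_(e < i.+1) 'C(i, e)%:R * t ^+ e *
    ((i - e == a)%N%:R * (e == c :> nat)%:R)).
  under eq_bigr => x _ do under eq_bigr => y _ do rewrite exprDn mulr_suml.
  under eq_bigr => x _ do rewrite exchange_big.
  rewrite exchange_big; apply: eq_bigr => e _ /=.
  have e_lt : (e < p)%N by have := ltn_ord e; lia.
  rewrite -(uP _ a_lt) 1?(leq_ltn_trans (leq_subr _ _)) // -(uP e_lt c_lt).
  rewrite big_distrlr /= mulr_sumr; apply: eq_bigr => x _.
  rewrite mulr_sumr; apply: eq_bigr => y _.
  by rewrite -mulr_natl exprMn; ring.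
have [<-|ne] := eqVneq (a + c)%N i.
  have c_le : (c < (a + c).+1)%N by lia.
  rewrite (bigD1 (Ordinal c_le)) //= addnK !eqxx big1 => [|e ne].
    by rewrite addr0 !mulr1 mul1r.
  suff /negPf-> : e != c :> nat by rewrite !mulr0.
  by [].
rewrite big1 ?mul0r // => e _; have e_le := ltn_ord e.
case: (eqVneq (i - e)%N a) => [e1|_]; case: (eqVneq (e : nat) c) => [e2|_];
  rewrite ?(mulr0, mul0r) //.
by case/negP: ne; apply/eqP; lia.
Qed.

(** The coefficients that, applied to a family of functions of w given by
    homogeneous polynomials of degree d in w = (1 : t), isolate the coefficient
    of t^k if s is k (with those of the powers equal to t^k as functions on F),
    and that of t^d if s is the point at infinity. For d >= p, where t^d is one
    of those powers for some k, its contribution is removed from the former. *)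
Definition row_coef (d : nat) (s : option nat) (w : line) : F :=
  match s, w with
  | Some k, Some t => u k t
  | Some k, None => if (d < p)%N then 0 else - \sum_t u k t * t ^+ d
  | None, Some _ => 0
  | None, None => 1
  end.

Definition row_fun (i j : nat) (s : option nat) (X : mat) : F :=
  \sum_w row_coef (i + j) s w * ((row_mul w X).1 ^+ i * (row_mul w X).2 ^+ j).

Definition degree_coef (d : nat) (s : option nat) (m : nat) : F :=
  \sum_t row_coef d s (Some t) * t ^+ m + row_coef d s None * (m == d)%:R.

(** The functional that extracts the coefficient of the monomial with exponents
    a, b, c, d. *)
Definition dual_monom (a b c d : nat) (X : mat) : F :=
  u a X.1.1 * u b X.1.2 * (u c X.2.1 * u d X.2.2).

Lemma row_fun_dual_monom (i j a b c d : nat) (s : option nat) :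
  (i < p)%N -> (j < p)%N -> (a < p)%N -> (b < p)%N -> (c < p)%N -> (d < p)%N ->
  \sum_X row_fun i j s X * dual_monom a b c d X =
  (a + c == i)%N%:R * (b + d == j)%N%:R * ('C(i, c)%:R * 'C(j, d)%:R) *
  degree_coef (i + j) s (c + d).
Proof.
move=> i_lt j_lt a_lt b_lt c_lt d_lt.
have sep (f g : F -> F -> F) :
  \sum_(X : mat) f X.1.1 X.2.1 * g X.1.2 X.2.2 =
  (\sum_x \sum_y f x y) * (\sum_x \sum_y g x y).
  rewrite -(pair_bigA _ (fun r1 r2 : vec => f r1.1 r2.1 * g r1.2 r2.2)) /=.
  rewrite -(pair_bigA _ (fun x x' => \sum_r2 f x r2.1 * g x' r2.2)) /=.
  rewrite big_distrlr /=; apply: eq_bigr => x _; apply: eq_bigr => x' _.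
  rewrite -(pair_bigA _ (fun y y' => f x y * g x' y')) /=.
  by rewrite big_distrlr.
under eq_bigr => X _ do rewrite mulr_suml.
rewrite exchange_big /degree_coef mulrDr /= (bigD1 None) //= addrC; congr (_ + _).
  rewrite (reindex_omap Some id) => [|[t|]] //=.
  rewrite (eq_bigl xpredT) => [|t]; last by rewrite eqxx.
  rewrite mulr_sumr; apply: eq_bigr => t _.
  transitivity (row_coef (i + j) s (Some t) *
    \sum_(X : mat) (X.1.1 + t * X.2.1) ^+ i * (u a X.1.1 * u c X.2.1) *
      ((X.1.2 + t * X.2.2) ^+ j * (u b X.1.2 * u d X.2.2))).
    by rewrite mulr_sumr; apply: eq_bigr => X _; rewrite /dual_monom /=; ring.
  rewrite (sep (fun x y => (x + t * y) ^+ i * (u a x * u c y))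
              (fun x y => (x + t * y) ^+ j * (u b x * u d y))).
  by rewrite !binom_coef // exprD; ring.
transitivity (row_coef (i + j) s None *
    \sum_(X : mat) X.1.1 ^+ 0 * u a X.1.1 * (X.2.1 ^+ i * u c X.2.1) *
      (X.1.2 ^+ 0 * u b X.1.2 * (X.2.2 ^+ j * u d X.2.2))).
  by rewrite mulr_sumr; apply: eq_bigr => X _; rewrite /dual_monom /=; ring.
rewrite (sep (fun x y => x ^+ 0 * u a x * (y ^+ i * u c y))
             (fun x y => x ^+ 0 * u b x * (y ^+ j * u d y))).
rewrite -!big_distrlr /= !uP ?prime_gt0 //.
rewrite [RHS]mulrCA; congr (_ * _).
have [<-|ai] := eqVneq (a + c)%N i; last first.
  rewrite !mul0r; case: eqVneq => [?|_]; case: eqVneq => [?|_];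
    rewrite ?(mul0r, mulr0) //.
  by case/negP: ai; apply/eqP; lia.
have [<-|bj] := eqVneq (b + d)%N j; last first.
  rewrite !(mul0r, mulr0); case: (eqVneq 0%N b) => [?|_];
    case: (eqVneq j d) => [?|_]; rewrite ?(mul0r, mulr0) //.
  by case/negP: bj; apply/eqP; lia.
have [<-|a0] := eqVneq 0%N a.
  have [<-|b0] := eqVneq 0%N b.
    by rewrite !add0n !eqxx !binn !mulr1.
  have /negPf-> : (c + d != (0 + c) + (b + d))%N by apply/eqP; lia.
  by rewrite !(mul0r, mulr0).
have /negPf-> : (c + d != (a + c) + (b + d))%N by apply/eqP; lia.
by rewrite !(mul0r, mulr0).
Qed.

(** The function [row_fun i j s] of X, or of its transpose if the boolean is
    true. *)
Definition item : Type := bool * nat * nat * option nat.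

(** For the side false, one s is admitted for each nonzero function of the form
    [row_fun i j s]; for the side true, those all of whose
    monomials have a degree at least p in one row. *)
Definition admissible (x : item) : bool :=
  let: (b, i, j, s) := x in
  [&& (i < p)%N, (j < p)%N &
  match b, s with
  | false, Some k => (k < p)%N && (k <= i + j)%N
  | false, None => (p <= i + j)%N
  | true, Some k => (p + k <= i + j)%N
  | true, None => (p <= i + j)%N
  end].

Definition item_fun (x : item) (X : mat) : F :=
  let: (b, i, j, s) := x in
  row_fun i j s (if b then transp X else X).

(** The functional extracting one monomial of column degrees (i, j) and second
    row degree s; for the side true, with rows and columns exchanged. *)
Definition pivot (x : item) (X : mat) : F :=
  let: (b, i, j, s) := x in
  let k := if s is Some k then k else (i + j)%N in
  let c := minn i k in
  dual_monom (i - c) (j - (k - c)) c (k - c) (if b then transp X else X).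

Lemma dual_monom_transp a b c d X :
  dual_monom a b c d (transp X) = dual_monom a c b d X.
Proof. by rewrite /dual_monom /=; ring. Qed.

Lemma sum_transp (f : mat -> F) : \sum_X f (transp X) = \sum_X f X.
Proof. by rewrite [RHS](reindex_inj (can_inj (@transpK F))). Qed.

Lemma degree_coef_small d k m : (k < p)%N -> (m < p)%N ->
  degree_coef d (Some k) m = (m == k)%:R.
Proof.
move=> k_lt m_lt; rewrite /degree_coef /=.
under eq_bigr => t _ do rewrite mulrC.
rewrite uP //; case: (ltnP d p) => [_|d_ge]; first by rewrite mul0r addr0.
have /negPf-> : m != d by apply/eqP; lia.
by rewrite mulr0 addr0.
Qed.

Lemma degree_coef_top d k : (p <= d)%N -> degree_coef d (Some k) d = 0.
Proof. by move=> d_ge; rewrite /degree_coef /= ltnNge d_ge eqxx mulr1 addrN. Qed.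

Lemma degree_coef_None d m : degree_coef d None m = (m == d)%:R.
Proof. by rewrite /degree_coef /= big1 ?add0r ?mul1r // => t _; rewrite mul0r. Qed.

Lemma binF_neq0 i c : (i < p)%N -> (c <= i)%N -> 'C(i, c)%:R != 0 :> F.
Proof.
move=> i_lt c_le; rewrite -(dvdn_pcharf pF); apply/negP => /dvdn_trans p_dvd.
have /p_dvd : ('C(i, c) %| i`!)%N by rewrite -(bin_fact c_le) dvdn_mulr.
elim: i i_lt {c_le p_dvd} => [_|i IH i_lt].
  by rewrite dvdn1 => /eqP p1; have := p_pr; rewrite p1.
rewrite factS Euclid_dvdM // => /orP [/dvdn_leq|]; first by lia.
by apply: IH; lia.
Qed.

Lemma sum_item_pivot_eq x : admissible x ->
  \sum_X item_fun x X * pivot x X != 0.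
Proof.
case: x => [[[b i] j] s] /and3P [i_lt j_lt s_ok].
pose k := if s is Some k then k else (i + j)%N.
pose c := minn i k.
have k_le : (k <= i + j)%N by rewrite /k; case: (s) (b) s_ok => [k'|] [] /=; lia.
have -> : \sum_X item_fun (b, i, j, s) X * pivot (b, i, j, s) X =
    \sum_X row_fun i j s X * dual_monom (i - c) (j - (k - c)) c (k - c) X.
  rewrite /item_fun /pivot -/k -/c.
  case: b {s_ok} => //=; exact: (sum_transp (fun X => row_fun i j s X *
    dual_monom (i - c) (j - (k - c)) c (k - c) X)).
rewrite row_fun_dual_monom //; try lia.
have -> : (i - c + c)%N = i by lia.
have -> : (j - (k - c) + (k - c))%N = j by lia.
have -> : (c + (k - c))%N = k by lia.
rewrite !eqxx !mul1r !mulf_neq0 ?binF_neq0 //; try lia.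
rewrite /k; case: s b @k @c k_le s_ok => [k|] b /= _ s_ok; last first.
  by rewrite degree_coef_None eqxx oner_eq0.
by rewrite degree_coef_small ?eqxx ?oner_eq0 //; case: b s_ok; lia.
Qed.

(** On the same side, the pivot of x' sees only functions with the same
    exponents i, j, and then [degree_coef] separates the values of s. Functions
    from different sides have no monomial in common: those from the side false
    have column degrees (i, j), both less than p, whereas on the side true one
    of the two column degrees of every monomial is at least p. *)
Lemma sum_item_pivot_neq x x' : admissible x -> admissible x' -> x != x' ->
  \sum_X item_fun x X * pivot x' X = 0.
Proof.
case: x x' => [[[b i] j] s] [[[b' i'] j'] s'].
move=> /and3P [i_lt j_lt s_ok] /and3P [i'_lt j'_lt s'_ok] ne.
pose k := if s' is Some k then k else (i' + j')%N.
pose c := minn i' k.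
have k_le : (k <= i' + j')%N by rewrite /k; case: (s') (b') s'_ok => [k'|] [] /=; lia.
have [eb|nb] := eqVneq b b'.
  have -> : \sum_X item_fun (b, i, j, s) X * pivot (b', i', j', s') X =
      \sum_X row_fun i j s X * dual_monom (i' - c) (j' - (k - c)) c (k - c) X.
    rewrite /item_fun /pivot -/k -/c -eb.
    case: b {s_ok ne eb} => //=; exact: (sum_transp (fun X => row_fun i j s X *
      dual_monom (i' - c) (j' - (k - c)) c (k - c) X)).
  rewrite row_fun_dual_monom //; try lia.
  have -> : (i' - c + c)%N = i' by lia.
  have -> : (j' - (k - c) + (k - c))%N = j' by lia.
  have -> : (c + (k - c))%N = k by lia.
  have [ei|_] := eqVneq i' i; last by rewrite !mul0r.
  have [ej|_] := eqVneq j' j; last by rewrite !(mulr0, mul0r).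
  subst b' i' j'; have ss' : s != s' by apply: contraNneq ne => ->.
  suff -> : degree_coef (i + j) s k = 0 by rewrite mulr0.
  rewrite /k {k_le ne}.
  case: s (s') ss' s_ok s'_ok => [l|] [l'|] //= ss' s_ok s'_ok.
  - rewrite degree_coef_small; try by case: b s_ok s'_ok; lia.
    by have /negPf-> // : l' != l by apply: contraNneq ss' => ->.
  - by rewrite degree_coef_top //; case: b s'_ok {s_ok}.
  - rewrite degree_coef_None.
    have /negPf-> // : l' != (i + j)%N by apply/eqP; case: b s_ok s'_ok; lia.
have -> : \sum_X item_fun (b, i, j, s) X * pivot (b', i', j', s') X =
    \sum_X row_fun i j s X * dual_monom (i' - c) c (j' - (k - c)) (k - c) X.
  rewrite /item_fun /pivot -/k -/c.
  case: b b' nb {s_ok s'_ok ne} => [] [] //= _.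
    rewrite -sum_transp; apply: eq_bigr => X _.
    by rewrite transpK dual_monom_transp.
  by apply: eq_bigr => X _; rewrite dual_monom_transp.
rewrite row_fun_dual_monom //; try lia.
have -> : (c + (k - c))%N = k by lia.
have -> : (j' - (k - c) + (k - c))%N = j' by lia.
have [ei|_] := eqVneq (i' - c + (j' - (k - c)))%N i; last by rewrite !mul0r.
have [ej|_] := eqVneq k j; last by rewrite !(mulr0, mul0r).
suff -> : degree_coef (i + j) s j' = 0 by rewrite mulr0.
case: b b' nb s_ok s'_ok {ne} => [] [] // _ s_ok s'_ok.
  case: s s_ok => [l|] s_ok; last first.
    by rewrite degree_coef_None; have /negPf-> // : j' != (i + j)%N by apply/eqP; lia.
  rewrite degree_coef_small //; last by lia.
  by have /negPf-> // : j' != l by apply/eqP; lia.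
exfalso; move: ei ej; rewrite /c /k; case: (s') s'_ok => [l|] s'_ok; lia.
Qed.

End ModP.

(** * The retraction *)

Section Retraction.
Variables (F : finFieldType) (p : nat).
Hypotheses (p_pr : prime p) (pF : p \in [pchar F]) (cardF : #|F| = p).
Variable rep : F -> nat.
Hypotheses (repK : forall a, (rep a)%:R = a) (rep_lt : forall a, (rep a < p)%N).
Local Notation vec := (F * F)%type.
Local Notation mat := (vec * vec)%type.
Local Notation line := (option F).

(** With i, j in [0, p) and s in P^1, the function (i, j, s) of the w X is kept
    when it is admissible. Otherwise d = i + j is less than p, and (i, j, s) is
    zero if s is some k > d, and equal to (i, j, d) if s is the point at
    infinity. When d > 0, it is then traded for a function of the X w of total
    degree p + d - 1, the row degrees recording s, and the column degrees
    recording i. The p triples with d = 0 and s other than 0 are those missing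
    from [basis_index]. *)
Definition item_of (x : vec * line) : item :=
  let i := rep x.1.1 in let j := rep x.1.2 in
  let s' := if j == 0%N then None else Some i in
  match x.2 with
  | Some t => let k := rep t in
      if (k <= i + j)%N then (false, i, j, Some k)
      else (true, k.-1, (p + (i + j) - k)%N, s')
  | None =>
      if (p <= i + j)%N then (false, i, j, None)
      else (true, p.-1, (i + j)%N, s')
  end.

Lemma rep_inj : injective rep.
Proof. exact: can_inj repK. Qed.

Lemma rep0 : rep 0 = 0%N.
Proof.
have := eqxx (0 : F); rewrite -{1}(repK 0) -(dvdn_pcharf pF).
have := rep_lt 0; case: (rep 0) => // n n_lt /dvdn_leq; lia.
Qed.

Lemma rep_eq0 t : (rep t == 0%N) = (t == 0).
Proof. by rewrite -{1}rep0 (inj_eq rep_inj). Qed.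

Lemma rep_gt0 (x : basis_index F) :
  (0 < rep (val x).1.1 + rep (val x).1.2)%N || ((val x).2 == Some 0).
Proof.
case: x => [[[a b] s] /= /orP [ab|->]]; last by rewrite orbT.
rewrite addn_gt0 !lt0n !rep_eq0.
by move: ab; rewrite xpair_eqE negb_and => ->.
Qed.

Lemma item_of_admissible (x : basis_index F) : admissible p (item_of (val x)).
Proof.
have := rep_gt0 x; case: x => [[[a b] [t|]] /= _].
  have := (rep_lt a, rep_lt b, rep_lt t); rewrite /item_of /= => -[[a_lt b_lt] t_lt].
  move=> x0; case: leqP => [t_le|t_gt]; first by apply/and3P; split=> //; apply/andP.
  have {}x0 : (0 < rep a + rep b)%N.
    by case/orP: x0 => // /eqP [t0]; move: t_gt; rewrite t0 rep0.
  by apply/and3P; split; first lia; first lia; case: eqP => b0; lia.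
have := (rep_lt a, rep_lt b); rewrite /item_of /= => -[a_lt b_lt].
rewrite orbF => x0; case: leqP => [d_ge|d_lt]; first by apply/and3P.
by apply/and3P; split; first lia; first lia; case: eqP => b0; lia.
Qed.

Lemma item_of_inj : injective (fun x : basis_index F => item_of (val x)).
Proof.
move=> x y; have := (rep_gt0 x, rep_gt0 y) => -[x_gt y_gt] eq_xy; apply: val_inj.
suff [] : [/\ rep (val x).1.1 = rep (val y).1.1, rep (val x).1.2 = rep (val y).1.2 &
    (val x).2 = (val y).2].
  case: x y {x_gt y_gt eq_xy} => [[[a b] s] ?] [[[a' b'] s'] ?] /=.
  by move=> /rep_inj -> /rep_inj -> ->.
case: x y x_gt y_gt eq_xy => [[[a b] s] xP] [[[a' b'] s'] yP] /=.
rewrite /item_of /=.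
have := (rep_lt a, rep_lt b, rep_lt a', rep_lt b') => -[[[a_lt b_lt] a'_lt] b'_lt].
have st (t : F) : (rep t < p)%N by [].
have tt (t t' : F) : rep t = rep t' -> Some t = Some t' by move=> /rep_inj ->.
case: s {xP} => [t|]; case: s' {yP} => [t'|]; rewrite ?(inj_eq Some_inj) -?rep_eq0.
- have := (st t, st t') => -[t_lt t'_lt]; move=> x0 y0.
  case: leqP => t_le; case: leqP => t'_le //.
    by move=> [-> -> e]; split=> //; apply: tt.
  move=> [ek ed]; have et : rep t = rep t' by lia.
  have es : (rep a + rep b = rep a' + rep b')%N by lia.
  case: eqP => b0; case: eqP => b'0 // e; split; try exact: tt; try lia.
    by case: e => ->.
  by case: e => e; lia.
- have t_lt := st t; move=> x0 y0.
  by case: leqP => t_le; case: leqP => d_le // [] *; exfalso; lia.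
- have t_lt := st t'; move=> x0 y0.
  by case: leqP => t_le; case: leqP => d_le // [] *; exfalso; lia.
move=> x0 y0; case: leqP => d_le; case: leqP => d'_le //; first by move=> [-> ->].
move=> [es]; case: eqP => b0; case: eqP => b'0 // e; split=> //; try lia.
  by case: e => ->.
by case: e => e; lia.
Qed.

Lemma intr_rep (a : F) : (rep a)%:R%:~R = a.
Proof. by rewrite rmorph_nat repK. Qed.

(** Integral lifts of the items and of their pivots have a pairing that is
    diagonal and invertible modulo p; as the items are indexed by the rational
    basis, the rank of the span of the generators does not drop modulo p. *)
Lemma items_pairing : exists (A : basis_index F -> gen_index F -> int)
    (D : mat -> basis_index F -> int),
  ~~ (p %| `|\det (mx_of A *m mx_of (@gen F) *m mx_of D)|)%N.
Proof.
have [u uP] := coef_functional F; rewrite cardF in uP.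
pose c (x : basis_index F) w (v : vec) : int :=
  let: (b, i, j, s) := item_of (val x) in
  (rep (row_coef p u (i + j) s w * (v.1 ^+ i * v.2 ^+ j)))%:R.
pose b (x : basis_index F) := (item_of (val x)).1.1.1.
exists (fun x g => (g.1.1 == b x)%:R * c x g.1.2 g.2).
exists (fun X x => (rep (pivot u (item_of (val x)) X))%:R).
have toF (n : int) : n%:~R != 0 :> F -> ~~ (p %| `|n|)%N.
  rewrite (dvdn_pcharf pF); apply: contra => /eqP n0; rewrite [n]intEsign.
  by rewrite rmorphM /= -pmulrn n0 mulr0.
apply: toF; rewrite -det_map_mx !mul_mx_of.
pose pair (x y : basis_index F) : F :=
  \sum_X item_fun p u (item_of (val x)) X * pivot u (item_of (val y)) X.
set M := map_mx _ _; have -> : M = mx_of pair.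
  apply/matrixP => i k; rewrite !mxE rmorph_sum; apply: eq_bigr => X _.
  rewrite rmorphM /= intr_rep; congr (_ * _).
  rewrite sum_gen rmorph_sum /c /b /item_fun /row_fun.
  case: (item_of _) => [[[b' i'] j'] s] /=.
  by apply: eq_bigr => w _; rewrite intr_rep.
rewrite det_mx_of_diag => [|x y xy]; last first.
  rewrite /pair (sum_item_pivot_neq p_pr pF uP) ?item_of_admissible //.
  by apply: contraNneq xy => /item_of_inj ->.
apply/prodf_neq0 => x _; apply: (sum_item_pivot_eq p_pr pF uP).
exact: item_of_admissible.
Qed.

(** The lattice spanned by the generators is a direct summand: f |-> f B gen
    maps onto it and fixes it. *)
Lemma gen_retraction : exists B : mat -> gen_index F -> int,
  forall g X, \sum_Y gen g Y * (\sum_g' B Y g' * gen g' X) = gen g X.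
Proof.
have [A' [D' det']] := items_pairing.
have [n detE] := det_basis F; rewrite cardF in detE.
have [A basisE] : exists A : basis_index F -> gen_index F -> int,
    forall x X, basis x X = \sum_g A x g * gen g X.
  by have [A AP] := choice (@basis_gen F); exists A.
have basisM : mx_of (@basis F) = mx_of A *m mx_of (@gen F).
  by rewrite mul_mx_of; apply/matrixP => i j; rewrite !mxE.
have pn0 : (p ^ n)%:R != 0 :> int by rewrite pnatr_eq0 expn_eq0 negb_and -lt0n prime_gt0.
set dC := \det _ in detE; set dA := \det _ in det'.
have d'0 : dA != 0 by apply: contraNneq det' => ->.
have co : coprimez dC dA.
  rewrite detE coprimezE natz /=; case: n {detE pn0} => [|n]; first exact: coprime1n.
  by rewrite coprime_pexpl // prime_coprime.
have [||B BP] := lattice_retraction (gen_sub_basis F) basisM erefl co.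
- by rewrite -/dC detE.
- by [].
rewrite [B]mx_ofK !mul_mx_of in BP.
exists (fun X g => B (enum_rank X) (enum_rank g)) => g X.
exact: (mx_of_inj g X BP).
Qed.

End Retraction.

(** * Generators as sums over cosets *)

Section Cosets.
Variable F : finFieldType.
Local Notation vec := (F * F)%type.
Local Notation mat := (vec * vec)%type.
Local Notation line := (option F).

(** The matrix product of the column c by the row r. *)
Definition outer (c r : vec) : mat := ((c.1 * r.1, c.1 * r.2), (c.2 * r.1, c.2 * r.2)).

Lemma sum_row_mul_coset (V : nmodType) (w : line) (c : vec) (X0 : mat) (f : mat -> V) :
  c != 0 -> dot w c = 0 ->
  \sum_(X | row_mul w X == row_mul w X0) f X = \sum_r f (X0 + outer c r).
Proof.
case: X0 => [[x11 x12] [x21 x22]]; case: c => [c1 c2].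
rewrite xpair_eqE negb_and /row_mul /=; case: w => [t|] /= c0 wc.
  have c2_0 : c2 != 0.
    by apply: contraTneq c0 => c20; move: wc; rewrite c20 mulr0 addr0 => ->; rewrite eqxx.
  have c1E : c1 = - t * c2 by apply/eqP; rewrite mulNr -addr_eq0 wc.
  rewrite (reindex_onto (fun r : vec => ((x11, x12), (x21, x22)) + outer (c1, c2) r)
    (fun X => ((X.2.1 - x21) / c2, (X.2.2 - x22) / c2))) => /= [|[[y11 y12] [y21 y22]]].
    apply: eq_bigl => -[r1 r2]; rewrite /= !xpair_eqE ![c2 * _]mulrC.
    rewrite ![_ + _ - _]addrC !addKr !mulfK // !eqxx andbT c1E.
    by rewrite andbT; apply/andP; split; apply/eqP; ring.
  rewrite xpair_eqE /outer /= => /andP [/eqP e1 /eqP e2].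
  congr ((_, _), (_, _)); rewrite ?c1E /=.
  - transitivity (y11 + t * y21 - t * y21); last by ring.
    by rewrite e1; field.
  - transitivity (y12 + t * y22 - t * y22); last by ring.
    by rewrite e2; field.
  - by field.
  - by field.
subst c2; rewrite eqxx orbF in c0.
rewrite (reindex_onto (fun r : vec => ((x11, x12), (x21, x22)) + outer (c1, 0) r)
  (fun X => ((X.1.1 - x11) / c1, (X.1.2 - x12) / c1))) => /= [|[[y11 y12] [y21 y22]]].
  apply: eq_bigl => -[r1 r2]; rewrite /= !xpair_eqE ![c1 * _]mulrC.
  by rewrite ![_ + _ - _]addrC !addKr !mulfK // !mul0r !addr0 !eqxx.
rewrite xpair_eqE /outer /= => /andP [/eqP -> /eqP ->].
by congr ((_, _), (_, _)) => /=; [field | field | ring | ring].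
Qed.

(** The fibres of X |-> w X are the cosets of the group of matrices c r with c
    a column orthogonal to w and r any row. *)
Lemma gen_relationP (V : zmodType) (f : mat -> V) :
  (forall g, \sum_X f X *~ gen g X = 0) <->
  (forall b c X0, c != 0 ->
    \sum_r f (X0 + if b then transp (outer c r) else outer c r) = 0).
Proof.
have sum_gen_eq b w v : \sum_X f X *~ gen (b, w, v) X =
    \sum_(X | row_mul w X == v) f (if b then transp X else X).
  rewrite [RHS]big_mkcond; have natE (P : bool) x : x *~ P%:R = (if P then x else 0) :> V.
    by case: P.
  case: b; rewrite /gen /=; last by apply: eq_bigr => X _; rewrite natE.
  rewrite (reindex_inj (can_inj (@transpK F))); apply: eq_bigr => X _.
  by rewrite transpK natE.
split=> [f0 b c X0 c0|f0 [[b w] v]].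
  have [w wc] : exists w, dot w c = 0.
    have [c2|c2] := eqVneq c.2 0; first by exists None.
    by exists (Some (- c.1 / c.2)) => /=; rewrite divfK // addrN.
  pose Y0 := if b then transp X0 else X0.
  have := f0 (b, w, row_mul w Y0).
  rewrite sum_gen_eq (sum_row_mul_coset _ _ c0 wc) => {2}<-.
  by apply: eq_bigr => r _; rewrite /Y0; case: (b).
rewrite sum_gen_eq.
have [c [c0 wc]] : exists c, c != 0 /\ dot w c = 0.
  case: w => [t|]; first exists (- t, 1); last exists (1, 0).
    by rewrite /= mulr1 addNr xpair_eqE oner_eq0 andbF.
  by rewrite /= xpair_eqE oner_eq0.
have [X0 <-] : exists X0, row_mul w X0 = v.
  case: w {wc} => [t|]; [exists (v, 0) | exists (0, v)];
    rewrite /row_mul /= ?mulr0 ?addr0; by case: v.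
rewrite (sum_row_mul_coset _ _ c0 wc) -[RHS](f0 b c (if b then transp X0 else X0) c0).
by apply: eq_bigr => r _; case: (b).
Qed.

End Cosets.

(** * The ring of full homomorphisms *)

Lemma mpoly_int_additive_eq0 (n : nat) (V : zmodType) (f : {mpoly int[n]} -> V) :
  zmod_morphism f -> (forall m, f 'X_[m] = 0) -> forall q, f q = 0.
Proof.
move=> fB fX q.
have f0 : f 0 = 0 by have := fB 0 0; rewrite !subrr.
have fN x : f (- x) = - f x by have := fB 0 x; rewrite !sub0r f0 sub0r.
have fD x y : f (x + y) = f x + f y by have := fB x (- y); rewrite fN !opprK.
have fMn x k : f (x *+ k) = f x *+ k.
  by elim: k => [|k IH]; rewrite ?mulr0n // !mulrS fD IH.
have fMz x k : f (x *~ k) = f x *~ k.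
  by case: k => k; rewrite ?NegzE ?mulrNz ?fN -!pmulrn fMn.
rewrite [q]mpolyE (big_morph f fD f0) big1 // => m _.
by rewrite -[_@__]intz scaler_int fMz fX mul0rz.
Qed.

Section Functionals.
Variable p : nat.
Hypothesis p_pr : prime p.
Local Notation F := 'F_p.
Local Notation vec := (F * F)%type.
Local Notation mat := (vec * vec)%type.

Definition exponents (m : 'X_{1..4}) : mat :=
  (((m (inord 0))%:R, (m (inord 1))%:R), ((m (inord 2))%:R, (m (inord 3))%:R)).

Lemma exponentsD m n : exponents (m + n)%MM = exponents m + exponents n.
Proof. by rewrite /exponents !mnmDE !natrD. Qed.

Lemma exponentsMp m : exponents (m *+ p)%MM = 0.
Proof. by rewrite /exponents !mulmnE !natrM pchar_Fp_0 // !mulr0. Qed.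

Variable h : mat -> int.

Definition mpoly_functional (q : {mpoly int[4]}) : int :=
  fglift (fun m => h (exponents m) : zmodule int) (mpoly_val q).

Lemma mpoly_functionalB : zmod_morphism mpoly_functional.
Proof.
move=> q r; have := lift_is_additive
  (fun m => h (exponents m) : zmodule int) (mpoly_val q) (mpoly_val r).
by [].
Qed.

Lemma mpoly_functionalX m : mpoly_functional 'X_[m] = h (exponents m).
Proof. by rewrite /mpoly_functional unlock liftU scale1r. Qed.

(** A functional of the exponents modulo p kills every multiple of X_i^p - 1. *)
Lemma mpoly_functional_hom q q' : quot_pi _ q = quot_pi _ q' :> hom_ring p ->
  mpoly_functional q = mpoly_functional q'.
Proof.
move=> /quot_piP /asboolP q_in; apply/eqP.
rewrite -subr_eq0 -mpoly_functionalB; apply/eqP.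
move: (q - q') q_in => {q q'} q q_in.
have lB := mpoly_functionalB; set l := mpoly_functional in lB *.
have l0 : l 0 = 0 by have := lB 0 0; rewrite !subrr.
(* The elements all of whose multiples are killed by l form an ideal. *)
suff : forall r, l (r * q) = 0 by move/(_ 1); rewrite mul1r.
apply: (q_in [set q | forall r, l (r * q) = 0]%classic); split; last first.
  move=> _ [i _ <-] /=; apply: mpoly_int_additive_eq0 => [x y|m].
    by rewrite mulrBl lB.
  rewrite mulrBr mulr1 lB mpolyXn -mpolyXD /l !mpoly_functionalX.
  by rewrite exponentsD exponentsMp addr0 subrr.
split=> [|a x lx r]; last by rewrite /= mulrA.
by split=> [r|x y lx ly r] /=; rewrite ?mulr0 // mulrBr lB lx ly subrr.
Qed.

Definition hom_functional (a : hom_ring p) : int := mpoly_functional (quot_repr a).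

Lemma hom_functional_pi q : hom_functional (quot_pi _ q) = mpoly_functional q.
Proof. exact/mpoly_functional_hom/quot_reprK. Qed.

Lemma hom_functionalB : zmod_morphism hom_functional.
Proof.
move=> a b; rewrite -[a]quot_reprK -[b]quot_reprK -raddfB !hom_functional_pi.
exact: mpoly_functionalB.
Qed.

End Functionals.
Section Monomials.
Variable p : nat.
Hypothesis p_pr : prime p.
Local Notation F := 'F_p.
Local Notation vec := (F * F)%type.
Local Notation mat := (vec * vec)%type.
Local Notation A := (hom_ring p).

Definition hom_monom (m : 'X_{1..4}) : A := quot_pi _ 'X_[m].

Lemma hom_monomD m n : hom_monom (m + n)%MM = hom_monom m * hom_monom n.
Proof. by rewrite /hom_monom mpolyXD rmorphM. Qed.

Lemma hom_monomMn m k : hom_monom (m *+ k)%MM = hom_monom m ^+ k.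
Proof. by rewrite /hom_monom -mpolyXn rmorphXn. Qed.

Lemma hom_monomUp i : hom_monom U_(i) ^+ p = 1.
Proof.
rewrite /hom_monom -rmorphXn -(rmorph1 (quot_pi _)).
by apply/quot_piP/asboolP => J [_]; apply; exists i.
Qed.

Lemma exponentsP m n : exponents p m = exponents p n ->
  forall i, m i = n i %[mod p].
Proof.
have modP (a b : nat) : a%:R = b%:R :> F -> a = b %[mod p].
  by move=> /(congr1 val); rewrite /= !val_Fp_nat.
move=> mn i; apply: modP; rewrite -[i]inord_val; case: i => [[|[|[|[|//]]]] /= _].
- exact: (congr1 (fun X : mat => X.1.1) mn).
- exact: (congr1 (fun X : mat => X.1.2) mn).
- exact: (congr1 (fun X : mat => X.2.1) mn).
- exact: (congr1 (fun X : mat => X.2.2) mn).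
Qed.

Lemma hom_monom_exponents m n : exponents p m = exponents p n ->
  hom_monom m = hom_monom n.
Proof.
move=> /exponentsP mn; rewrite /hom_monom !mpolyXE_id !rmorph_prod.
apply: eq_bigr => i _; rewrite !rmorphXn /= -!/(hom_monom _).
by rewrite -(expr_mod _ (hom_monomUp i)) mn (expr_mod _ (hom_monomUp i)).
Qed.

Definition mnm_of (X : mat) : 'X_{1..4} :=
  (U_(inord 0) *+ X.1.1 + U_(inord 1) *+ X.1.2 +
   (U_(inord 2) *+ X.2.1 + U_(inord 3) *+ X.2.2))%MM.

Lemma mnm1_inord i j : (i < 4)%N -> (j < 4)%N ->
  U_(inord i)%MM (inord j : 'I_4) = (i == j) :> nat.
Proof. by move=> i4 j4; rewrite mnmE -val_eqE /= !inordK. Qed.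

Lemma exponents_mnm_of X : exponents p (mnm_of X) = X.
Proof.
rewrite /exponents !mnmDE !mulmnE !mnm1_inord //=.
rewrite !(mul0n, mul1n, addn0, add0n) !natr_Zp.
by case: X => [[a b] [c d]].
Qed.

Lemma sum_ord_Fp (V : nmodType) (f : F -> V) : \sum_(k < p) f k%:R = \sum_a f a.
Proof.
rewrite [RHS](reindex (fun k : 'I_p => k%:R : F)) //.
apply/onW_bij/inj_card_bij; last by rewrite card_Fp // card_ord.
move=> k k' /(congr1 val); rewrite /= !val_Fp_nat // !modn_small //.
exact: val_inj.
Qed.

Lemma Phi_monomE m n : Phi (hom_monom m) * Phi (hom_monom n) =
  \sum_(k < p) \sum_(l < p) hom_monom (m *+ k + n *+ l)%MM.
Proof.
rewrite big_distrlr; apply: eq_bigr => k _; apply: eq_bigr => l _.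
by rewrite hom_monomD !hom_monomMn.
Qed.

Local Notation pt i j := (hom_coord p i, hom_coord p j).
Local Notation row_eqs := (lin_indep_eqs (pt 0 1) (pt 2 3)).
Local Notation col_eqs := (lin_indep_eqs (pt 0 2) (pt 1 3)).

(** The product Phi(x) Phi(y) at two monomials is the sum over the subgroup
    spanned by their exponents, which here consists of the c r or of their
    transposes. *)
Lemma full_eqs_monom (a : A) : (row_eqs `|` col_eqs)%classic a <->
  exists b c, c != 0 /\ a = \sum_(r : vec) hom_monom (mnm_of
    (if b then transp (outer c r) else outer c r)).
Proof.
have E (m n : 'X_{1..4}) (f : vec -> mat) :
    (forall k l, exponents p (m *+ k + n *+ l)%MM = f (k%:R, l%:R)) ->
    Phi (hom_monom m) * Phi (hom_monom n) = \sum_r hom_monom (mnm_of (f r)).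
  move=> mnf; rewrite Phi_monomE.
  rewrite [RHS](eq_bigr (fun r : vec => hom_monom (mnm_of (f (r.1, r.2))))); last by case.
  rewrite -(pair_bigA _ (fun k l : F => hom_monom (mnm_of (f (k, l))))) /= -sum_ord_Fp.
  apply: eq_bigr => k _; rewrite -sum_ord_Fp; apply: eq_bigr => l _.
  by apply: hom_monom_exponents; rewrite exponents_mnm_of.
have Erow c : primitive_eq (mu_comb (pt 0 1) (pt 2 3) c) =
    \sum_r hom_monom (mnm_of (outer c r)).
  rewrite /primitive_eq /mu_comb /= -!/(hom_monom _) -!hom_monomMn -!hom_monomD.
  apply: E => k l; rewrite /exponents !mnmDE !mulmnE !mnmDE !mulmnE !mnm1_inord //=.
  by rewrite !(mul0n, mul1n, addn0, add0n) !natrM !natr_Zp.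
have Ecol c : primitive_eq (mu_comb (pt 0 2) (pt 1 3) c) =
    \sum_r hom_monom (mnm_of (transp (outer c r))).
  rewrite /primitive_eq /mu_comb /= -!/(hom_monom _) -!hom_monomMn -!hom_monomD.
  apply: (E _ _ (fun r => transp (outer c r))) => k l.
  rewrite /exponents !mnmDE !mulmnE !mnmDE !mulmnE !mnm1_inord //=.
  by rewrite !(mul0n, mul1n, addn0, add0n) !natrM !natr_Zp.
split=> [[] [c c0 <-]|[b [c [c0 ->]]]].
- by exists false, c; rewrite Erow.
- by exists true, c; rewrite Ecol.
case: b.
- right; exists c; [exact: c0 | exact: Ecol].
- left; exists c; [exact: c0 | exact: Erow].
Qed.

End Monomials.
Section FullFunctional.
Variable p : nat.
Hypothesis p_pr : prime p.
Local Notation F := 'F_p.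
Local Notation vec := (F * F)%type.
Local Notation mat := (vec * vec)%type.

Definition full_monom (m : 'X_{1..4}) : full_hom_ring p := quot_pi _ (hom_monom p m).

Lemma full_monom_relation (g : gen_index F) :
  \sum_X full_monom (mnm_of X) *~ gen g X = 0.
Proof.
move: g; apply/(gen_relationP (fun X => full_monom (mnm_of X))) => b c X0 c0.
pose f (r : vec) := if b then transp (outer c r) else outer c r.
transitivity (quot_pi _ (hom_monom p (mnm_of X0) *
    \sum_r hom_monom p (mnm_of (f r))) : full_hom_ring p).
  rewrite mulr_sumr raddf_sum; apply: eq_bigr => r _.
  rewrite -hom_monomD /full_monom; congr quot_pi; apply: hom_monom_exponents => //.
  by rewrite exponentsD !exponents_mnm_of.
rewrite -[RHS](raddf0 (quot_pi _)); apply/quot_piP; rewrite subr0.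
apply/ideal_genM/asboolP => J [_]; apply; apply/full_eqs_monom => //.
by exists b, c.
Qed.

Lemma full_additive_eq0 (V : zmodType) (f : full_hom_ring p -> V) :
  zmod_morphism f -> (forall m, f (full_monom m) = 0) -> forall x, f x = 0.
Proof.
move=> fB fm x; rewrite -[x]quot_reprK -[quot_repr x]quot_reprK.
apply: (mpoly_int_additive_eq0 (f := fun q => f (quot_pi _ (quot_pi _ q)))) => // q r.
by rewrite !raddfB fB.
Qed.

Variable h : mat -> int.
Hypothesis h_gen : forall g, \sum_X gen g X * h X = 0.

Definition full_functional (x : full_hom_ring p) : int :=
  hom_functional h (quot_repr x).

(** A function h orthogonal to the generators is orthogonal to all their
    translates, these being generators too; so it kills the ideal. *)
Lemma full_functional_pi a : full_functional (quot_pi _ a) = hom_functional h a.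
Proof.
have lB := hom_functionalB p_pr h; set l := hom_functional h in lB *.
have l0 : l 0 = 0 by have := lB 0 0; rewrite !subrr.
have /quot_piP/asboolP a_in := quot_reprK (quot_pi _ a : full_hom_ring p).
apply/eqP; rewrite -subr_eq0 -lB; apply/eqP; move: (_ - a) a_in => {}a a_in.
(* The elements all of whose multiples are killed by l form an ideal. *)
suff : forall b, l (b * a) = 0 by move/(_ 1); rewrite mul1r.
apply: (a_in [set a | forall b, l (b * a) = 0]%classic); split.
  split=> [|a' x lx b]; last by rewrite /= mulrA.
  by split=> [b|x y lx ly b] /=; rewrite ?mulr0 // mulrBr lB lx ly subrr.
move=> _ /(full_eqs_monom p_pr) [b [c [c0 ->]]] /= a'.
rewrite -[a']quot_reprK; move: (quot_repr a').
apply: mpoly_int_additive_eq0 => [x y|m].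
  by rewrite raddfB mulrBl lB.
have lD x y : l (x + y) = l x + l y.
  by have lN := lB 0 y; have := lB x (- y); rewrite opprK -[- y]sub0r lN l0 sub0r opprK.
rewrite mulr_sumr (big_morph l lD l0).
have h_rel g : \sum_X h X *~ gen g X = 0.
  by rewrite -[RHS](h_gen g); apply: eq_bigr => X _; rewrite -mulrzr intz mulrC.
rewrite -[RHS]((gen_relationP h).1 h_rel b c (exponents p m) c0).
apply: eq_bigr => r _; rewrite -[quot_pi _ _]/(hom_monom p m) -hom_monomD.
rewrite /l /hom_monom hom_functional_pi // mpoly_functionalX.
by rewrite exponentsD exponents_mnm_of.
Qed.

Lemma full_functionalB : zmod_morphism full_functional.
Proof.
move=> x y; rewrite -[x]quot_reprK -[y]quot_reprK -raddfB !full_functional_pi.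
exact: hom_functionalB.
Qed.

Lemma full_functional_monom m : full_functional (full_monom m) = h (exponents p m).
Proof. by rewrite full_functional_pi hom_functional_pi // mpoly_functionalX. Qed.

End FullFunctional.

(** The coordinate functions are the columns h X of 1 - P, with P the retraction
    onto the span of the generators: they vanish on the generators because P
    fixes them, and 1 - P induces the identity on the quotient because the
    image of P maps to zero there. *)
Theorem theorem1p1 (p : nat) (hp : prime p) :
  @flat int (zmodule (full_hom_ring p)).
Proof.
pose F := 'F_p; pose mat : finType := ((F * F) * (F * F))%type.
have rep_lt (a : F) : (a < p)%N by rewrite -{2}(Fp_cast hp) ltn_ord.
have [B BP] := gen_retraction hp (pchar_Fp hp) (card_Fp hp) (@natr_Zp _) rep_lt.
pose P (Y X : mat) := \sum_g B Y g * gen g X.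
pose h (X Y : mat) : int := (Y == X)%:R - P Y X.
have h_gen X g : \sum_Y gen g Y * h X Y = 0.
  under eq_bigr => Y _ do rewrite mulrBr [gen g Y * _%:R]mulrC.
  by rewrite sumrB sum_delta BP subrr.
pose e (X : mat) := full_monom p (mnm_of X).
pose lam (X : mat) := full_functional (h X).
have lamB X : zmod_morphism (lam X) by apply: full_functionalB.
have lam0 X : lam X 0 = 0 by have := lamB X 0 0; rewrite !subrr.
have lamN X x : lam X (- x) = - lam X x by have := lamB X 0 x; rewrite !sub0r lam0 sub0r.
have lamD X x y : lam X (x + y) = lam X x + lam X y.
  by have := lamB X x (- y); rewrite lamN !opprK.
apply: (@flat_dual_basis int (zmodule (full_hom_ring p)) mat e lam).
- exact: lamD.
- move=> X a x.
  have lamMn k : lam X (x *+ k) = lam X x *+ k.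
    by elim: k => [|k IH]; rewrite ?mulr0n // !mulrS lamD IH.
  rewrite -[a *: x]/((x : full_hom_ring p) *~ a) -[a in RHS]intz mulrzl.
  by case: a => k; rewrite ?NegzE ?mulrNz ?lamN -!pmulrn lamMn.
move=> x; apply/eqP; rewrite -subr_eq0; apply/eqP.
pose f (x : full_hom_ring p) := x - \sum_X e X *~ lam X x.
apply: (full_additive_eq0 (f := f)) => [y z|m]; rewrite /f.
  rewrite (eq_bigr (fun X => e X *~ lam X y - e X *~ lam X z)).
    by rewrite sumrB !opprD !opprK addrACA.
  by move=> X _; rewrite -mulrzBr lamB.
have PE : \sum_X e X *~ P (exponents p m) X = 0.
  under eq_bigr => X _ do rewrite mulrz_sumr.
  rewrite exchange_big big1 // => g _ /=.
  under eq_bigr => X _ do rewrite mulrC mulrzA.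
  by rewrite -mulrz_suml full_monom_relation // mul0rz.
under eq_bigr => X _ do rewrite /lam full_functional_monom // mulrzBr.
rewrite sumrB PE subr0 (bigD1 (exponents p m)) //= eqxx mulr1z big1 => [|X neX].
  rewrite addr0 /e /full_monom; apply/eqP; rewrite subr_eq0; apply/eqP; congr quot_pi.
  by apply: hom_monom_exponents => //; rewrite exponents_mnm_of.
by rewrite eq_sym (negPf neX) mulr0z.
Qed.
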